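(* For every integer $n\ge1$, the polynomial $P_n(x)$ has exactly $n-1$ roots $x^n_i$, $i=1,\dots,n-1$, in the interval $(-1,1)$, and an additional isolated root $x_n:=x^n_n$ in the interval $\big(\frac{6+\sqrt2}{4},\,2\big]$. Furthermore, the isolated root is $x_n=\cosh\omega_n$, where $\omega_n$ is the unique root of the equation $$\coth(n\omega)=\frac{3\cosh\omega-4}{\sinh\omega},\qquad \omega\in(0,\infty).$$ Besides, $x_1=2$, and the sequence of isolated roots $(x_n)_{n\ge1}$ decreasingly converges to the limit value $x_\infty=\frac{6+\sqrt2}{4}$.
   Context: The polynomials $P_n$ are defined by $P_0(x)=-1$, $P_1(x)=2x-4$, and $P_n(x)=2x\,P_{n-1}(x)-P_{n-2}(x)$ for $n\ge2$; $P_n$ has degree $n$. *)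

(* Defs.v *)
From HB Require Import structures.
From mathcomp Require Import all_boot all_order all_algebra.
From mathcomp Require Import all_classical all_reals all_analysis.

Set Implicit Arguments.
Unset Strict Implicit.
Unset Printing Implicit Defensive.

Import Order.TTheory GRing.Theory Num.Theory.
Import numFieldNormedType.Exports.
Local Open Scope ring_scope.

Fixpoint P (R : nzRingType) (n : nat) : {poly R} :=
  match n with
  | 0 => -1
  | 1 => 2 * 'X - 4
  | (k.+1 as m).+1 => 2 * 'X * P R m - P R k
  end.

Definition cosh (R : realType) (x : R) : R := (expR x + expR (- x)) / 2.

Definition sinh (R : realType) (x : R) : R := (expR x - expR (- x)) / 2.

(* As [_ / 0 = 0], [coth 0] takes the junk value [0]. *)
Definition coth (R : realType) (x : R) : R := cosh x / sinh x.

(* Main.v *)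
Require Import Defs.
From HB Require Import structures.
From mathcomp Require Import all_boot all_order all_algebra.
From mathcomp Require Import all_classical all_reals all_analysis.
From mathcomp Require Import ring lra.

Set Implicit Arguments.
Unset Strict Implicit.
Unset Printing Implicit Defensive.

Import Order.TTheory GRing.Theory Num.Theory.
Import numFieldNormedType.Exports.
Local Open Scope classical_set_scope.
Local Open Scope ring_scope.

(** For a fixed point [x], the numbers [(P R n).[x]] satisfy the Chebyshev
    recurrence, so they are known as soon as two initial values are.  With
    [x = cos a], respectively [x = cosh w], this gives
<<
  sin a  * P_n (cos a)  = - cos (n a)  * sin a  + (3 cos a - 4)  * sin (n a)
  sinh w * P_n (cosh w) = - cosh (n w) * sinh w + (3 cosh w - 4) * sinh (n w)
>>
    (both are [P_horner_CS]), and every claim is read off these formulas.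

    At the points [cos (k pi / n)] with [0 < k < n] the sine of [n a] vanishes
    and [P_n] takes the value [- (-1) ^ k]; at [k = 0], that is at [1], it still
    has the sign of this expression ([P_horner1]).  The [n - 1] sign changes for
    [k < n] give [n - 1] roots in [(-1, 1)] ([P_inner_roots]).

    On [(1, +oo)] a root is exactly a solution of the equation in [coth]
    ([coth_eq_root]).  As [n] grows, [coth (n w)] tends to [1], and the limit
    equation [3 cosh w - 4 = sinh w] becomes [z ^ 2 - 4 z + 2 = 0] for
    [z = exp w], so [z = 2 + sqrt 2] and [cosh w = (6 + sqrt 2) / 4].  At this
    limit point the growing exponential drops out: [P_n] equals minus the
    [n]-th power of [1 / z] ([P_horner_xinf]), hence is negative, whereas
    [P_n (2) >= 0].  So there is a root in between, and the bound on the degree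
    leaves no room for any other root outside [(-1, 1)] ([P_root_complete]).

    By this uniqueness, [P_n (y) > 0] at some [y] beyond the limit point already
    forces the isolated root to lie below [y].  The sequence decreases because
    [P_(n+1)] is positive at the isolated root of [P_n] ([P_next_gt0]), and it
    converges because [P_n (y)] is eventually positive at each fixed [y] beyond
    the limit point ([P_eventually_gt0]). *)

(** * The three-term recurrence and its solutions *)

Definition three_term (R : nzRingType) (x : R) (u : nat -> R) :=
  forall n, u n.+2 = 2 * x * u n.+1 - u n.

Lemma three_term_unique (R : nzRingType) (x : R) (u v : nat -> R) :
  three_term x u -> three_term x v -> u 0%N = v 0%N -> u 1%N = v 1%N ->
  forall n, u n = v n.
Proof.
move=> hu hv e0 e1 n.
suff [] : u n = v n /\ u n.+1 = v n.+1 by [].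
by elim: n => [//|n [en en1]]; split; rewrite // hu hv en en1.
Qed.

Lemma P_three_term (R : comNzRingType) (x : R) :
  three_term x (fun n => (P R n).[x]).
Proof.
move=> n; have -> : P R n.+2 = 2 * 'X * P R n.+1 - P R n by [].
by rewrite !hornerE.
Qed.

Lemma P0_horner (R : comNzRingType) (x : R) : (P R 0).[x] = -1.
Proof. by rewrite /= !hornerE. Qed.

Lemma P1_horner (R : comNzRingType) (x : R) : (P R 1).[x] = 2 * x - 4.
Proof. by rewrite /= !hornerE /=; ring. Qed.

Lemma P_horner_unique (R : comNzRingType) (x : R) (u : nat -> R) :
  three_term x u -> u 0%N = -1 -> u 1%N = 2 * x - 4 ->
  forall n, (P R n).[x] = u n.
Proof.
move=> hu u0 u1; apply: (@three_term_unique _ x (fun n => (P R n).[x])) => //.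
- exact: P_three_term.
- by rewrite P0_horner u0.
- by rewrite P1_horner u1.
Qed.

(** [C] and [S] play the parts of cosine and sine: multiplied by [S 1], both
    sides solve the recurrence with the same two initial values.  Keeping [C]
    and [S] abstract serves the circular and the hyperbolic case at once. *)
Lemma P_horner_CS (R : comNzRingType) (x : R) (C S : nat -> R) :
  three_term x C -> three_term x S -> C 0%N = 1 -> C 1%N = x -> S 0%N = 0 ->
  forall n, S 1%N * (P R n).[x] = - C n * S 1%N + (3 * x - 4) * S n.
Proof.
move=> hC hS C0 C1 S0.
apply: (@three_term_unique _ x) => [n|n||].
- by rewrite P_three_term; ring.
- by rewrite hC hS; ring.
- by rewrite P0_horner C0 S0; ring.
- by rewrite P1_horner C1; ring.
Qed.

Lemma size_P (R : comNzRingType) (n : nat) : (size (P R n) <= n.+1)%N.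
Proof.
suff [] : (size (P R n) <= n.+1)%N /\ (size (P R n.+1) <= n.+2)%N by [].
have size2X : (size (2 * 'X : {poly R})%R <= 2)%N.
  rewrite mulr_natl -scaler_nat; apply: leq_trans (size_scale_leq _ _) _.
  by rewrite size_polyX.
elim: n => [|n [hn hn1]].
  split; first by rewrite size_polyN size_poly1.
  apply: leq_trans (size_polyD _ _) _; rewrite geq_max size2X size_polyN.
  rewrite -(mulr1 4) mulr_natl -scaler_nat.
  apply: leq_trans (size_scale_leq _ _) _.
  by rewrite size_poly1.
split=> //; apply: leq_trans (size_polyD _ _) _; rewrite geq_max.
apply/andP; split; last by rewrite size_polyN (leq_trans hn) // ltnW.
apply: leq_trans (size_polyMleq _ _) _.
by have := leq_add size2X hn1; case: (_ + _)%N.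
Qed.

(** * Hyperbolic functions and the rightmost root *)

Lemma expR_cosh_sinh (R : realType) (v : R) :
  expR v = cosh v + sinh v /\ expR (- v) = cosh v - sinh v.
Proof. by rewrite /cosh /sinh; split; field. Qed.

Lemma cosh_sqr (R : realType) (v : R) : cosh v ^+ 2 = 1 + sinh v ^+ 2.
Proof.
have [e1 e2] := expR_cosh_sinh v.
by rewrite -(expRxMexpNx_1 v) e1 e2; ring.
Qed.

Lemma coshD (R : realType) (a b : R) :
  cosh (a + b) = cosh a * cosh b + sinh a * sinh b.
Proof. by rewrite /cosh /sinh opprD !expRD; field. Qed.

Lemma sinhD (R : realType) (a b : R) :
  sinh (a + b) = sinh a * cosh b + cosh a * sinh b.
Proof. by rewrite /cosh /sinh opprD !expRD; field. Qed.

Lemma cosh0 (R : realType) : cosh 0 = 1 :> R.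
Proof. by rewrite /cosh oppr0 expR0; field. Qed.

Lemma sinh0 (R : realType) : sinh 0 = 0 :> R.
Proof. by rewrite /sinh oppr0 subrr mul0r. Qed.

(** The linear growth of [sinh (n w)] in [n] is all that the convergence
    proof needs; it comes from [expR v >= 1 + v] and [expR (- v) <= 1]. *)
Lemma sinh_ge_half (R : realType) (v : R) : 0 <= v -> v / 2 <= sinh v.
Proof.
move=> v0; have h1 := expR_ge1Dx v.
have h2 : expR (- v) <= 1 by rewrite -[leRHS]expR0 ler_expR oppr_le0.
by rewrite /sinh; lra.
Qed.

Lemma sinh_gt0 (R : realType) (v : R) : 0 < v -> 0 < sinh v.
Proof.
by move=> v0; apply: lt_le_trans (sinh_ge_half (ltW v0)); rewrite divr_gt0.
Qed.

(** The difference of the two sides is [(b - a) * (1 - a^-1 * b^-1)].  With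
    [a] and [b] exponentials, this is the monotonicity of [cosh]. *)
Lemma addV_lt (R : realFieldType) (a b : R) :
  1 <= a -> a < b -> a + a^-1 < b + b^-1.
Proof.
move=> a1 ab; have a0 : 0 < a by lra.
have b0 : 0 < b by lra.
have : 0 < (b - a) * (1 - a^-1 * b^-1).
  apply: mulr_gt0; first by lra.
  rewrite subr_gt0 -invfM invf_lt1; first by nra.
  exact: mulr_gt0.
have -> : (b - a) * (1 - a^-1 * b^-1) = b + b^-1 - (a + a^-1).
  by field; rewrite !gt_eqF.
by lra.
Qed.

Lemma cosh_expR (R : realType) (v : R) : cosh v = (expR v + (expR v)^-1) / 2.
Proof. by rewrite /cosh expRN. Qed.

Lemma cosh_lt (R : realType) (a b : R) : 0 <= a -> a < b -> cosh a < cosh b.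
Proof.
move=> a0 ab; rewrite !cosh_expR ltr_pM2r; last by rewrite invr_gt0.
by apply: addV_lt; rewrite ?ltr_expR // -expR0 ler_expR.
Qed.

Lemma cosh_inj_pos (R : realType) (a b : R) :
  0 < a -> 0 < b -> cosh a = cosh b -> a = b.
Proof.
move=> a0 b0 e; case: (ltgtP a b) => // /cosh_lt h.
- by have := h (ltW a0); rewrite e ltxx.
- by have := h (ltW b0); rewrite e ltxx.
Qed.

Lemma cosh_gt1 (R : realType) (v : R) : 0 < v -> 1 < cosh v.
Proof. by move=> v0; rewrite -(cosh0 R); apply: cosh_lt. Qed.

Lemma cosh_surj (R : realType) (x : R) : 1 < x -> exists2 w, 0 < w & cosh w = x.
Proof.
move=> x1.
(* [exp w] is the larger root of [z ^ 2 - 2 x z + 1]. *)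
set r := Num.sqrt (x ^+ 2 - 1).
have r0 : 0 <= r by apply: sqrtr_ge0.
have r2 : r ^+ 2 = x ^+ 2 - 1 by rewrite sqr_sqrtr //; nra.
have z0 : x + r \is Num.pos by rewrite posrE; lra.
exists (ln (x + r)); first by apply: ln_gt0; lra.
rewrite cosh_expR lnK //.
have -> : (x + r)^-1 = x - r.
  have zn0 : x + r != 0 by rewrite gt_eqF.
  by apply: (mulfI zn0); rewrite mulfV //; ring: r2.
by field.
Qed.

Lemma three_term_hyp (R : realType) (w : R) :
  three_term (cosh w) (fun n => cosh (n%:R * w)) /\
  three_term (cosh w) (fun n => sinh (n%:R * w)).
Proof.
have h := cosh_sqr w.
split=> n;
  have -> : n.+2%:R * w = n%:R * w + w + w by rewrite -addn2 natrD; ring.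
- have -> : n.+1%:R * w = n%:R * w + w by rewrite -addn1 natrD; ring.
  by rewrite !(coshD, sinhD); ring: h.
- have -> : n.+1%:R * w = n%:R * w + w by rewrite -addn1 natrD; ring.
  by rewrite !(coshD, sinhD); ring: h.
Qed.

Lemma P_horner_cosh (R : realType) (n : nat) (w : R) :
  sinh w * (P R n).[cosh w] =
  - cosh (n%:R * w) * sinh w + (3 * cosh w - 4) * sinh (n%:R * w).
Proof.
have [hC hS] := three_term_hyp w.
have := P_horner_CS hC hS; rewrite !mul0r !mul1r.
by apply; [exact: cosh0 | | exact: sinh0].
Qed.

Lemma natM_gt0 (R : realType) (n : nat) (w : R) :
  (1 <= n)%N -> 0 < w -> 0 < n%:R * w.
Proof. by move=> n0 w0; rewrite mulr_gt0 // ltr0n. Qed.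

Lemma coth_eq_root (R : realType) (n : nat) (w : R) : (1 <= n)%N -> 0 < w ->
  coth (n%:R * w) = (3 * cosh w - 4) / sinh w <-> root (P R n) (cosh w).
Proof.
move=> n1 w0; have s0 := sinh_gt0 w0.
have sn0 := sinh_gt0 (natM_gt0 n1 w0).
have h := P_horner_cosh n w.
have -> : root (P R n) (cosh w) = (sinh w * (P R n).[cosh w] == 0).
  by rewrite mulf_eq0 gt_eqF.
rewrite /coth h mulNr [- _ + _]addrC subr_eq0 eq_sym.
by rewrite -eqr_div ?lt0r_neq0 //; split=> /eqP.
Qed.

(** * Values at the limit point, at 1 and at 2 *)

Definition xinf (R : rcfType) : R := (6 + Num.sqrt 2) / 4.

Lemma sqrt2_bounds (R : rcfType) :
  Num.sqrt 2 ^+ 2 = 2 :> R /\ 1 < Num.sqrt (2 : R) < 2.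
Proof.
have e : Num.sqrt 2 ^+ 2 = 2 :> R by rewrite sqr_sqrtr.
have g : 0 <= Num.sqrt (2 : R) by apply: sqrtr_ge0.
by split=> //; apply/andP; split; nra.
Qed.

Lemma xinf_bounds (R : rcfType) : 1 < xinf R < 2.
Proof. by have [_ /andP[h1 h2]] := sqrt2_bounds R; rewrite /xinf; lra. Qed.

(** [1 - sqrt 2 / 2] is the inverse of [2 + sqrt 2] and thus the small root of
    [z ^ 2 - 2 x z + 1] at [x = xinf]; its powers solve the recurrence there. *)
Lemma P_horner_xinf (R : rcfType) (n : nat) :
  (P R n).[xinf R] = - (1 - Num.sqrt 2 / 2) ^+ n.
Proof.
have [s2 _] := sqrt2_bounds R.
apply: (@P_horner_unique _ _ (fun n => - (1 - Num.sqrt 2 / 2) ^+ n)).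
- by move=> k; rewrite /xinf !exprS; field: s2.
- by rewrite expr0.
- by rewrite /xinf expr1; field.
Qed.

Lemma P_xinf_lt0 (R : rcfType) (n : nat) : (P R n).[xinf R] < 0.
Proof.
have [_ /andP[h1 h2]] := sqrt2_bounds R.
by rewrite P_horner_xinf oppr_lt0 exprn_gt0 //; lra.
Qed.

Lemma P_horner1 (R : comNzRingType) (n : nat) : (P R n).[1] = - n.+1%:R.
Proof.
apply: (@P_horner_unique _ _ (fun n => - n.+1%:R)).
- by move=> k; rewrite -[k.+3]addn3 -[k.+2]addn2 -[k.+1]addn1 !natrD; ring.
- by [].
- by ring.
Qed.

(** The values at [2] start from [0] at [n = 1] and increase from there:
    [4 b - a >= b] when [b >= 0] and [b >= a]. *)
Lemma P_horner2_ge0 (R : realFieldType) (n : nat) :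
  (1 <= n)%N -> 0 <= (P R n).[2].
Proof.
case: n => // n _.
suff [] : 0 <= (P R n.+1).[2] /\ (P R n).[2] <= (P R n.+1).[2] by [].
elim: n => [|n [h1 h2]]; first by rewrite P0_horner P1_horner; lra.
by rewrite (P_three_term 2 n); lra.
Qed.

(** * The roots in the open interval *)

(** The intermediate value theorem, applied between consecutive points; the
    points decrease to match [cos (k pi / n)]. *)
Lemma sign_change_roots (R : rcfType) (p : {poly R}) (t : nat -> R) (m : nat) :
  (forall k, (k < m)%N -> t k.+1 < t k) ->
  (forall k, (k <= m)%N -> p.[t k] * (-1) ^+ k < 0) ->
  exists s : seq R, [/\ uniq s, size s = m, all (root p) s
    & forall y, y \in s -> t m < y < t 0%N].
Proof.
elim: m => [|m IH] ht hp; first by exists [::].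
have [|k km|s [us ss rs bs]] := IH.
- by move=> k km; apply/ht/(leq_trans km).
- by apply/hp/(leq_trans km).
have tm0 : t m <= t 0%N.
  elim: m {IH hp us ss rs bs} ht => [//|m IH] ht.
  apply: le_trans (IH _); first by apply/ltW/ht.
  by move=> k km; apply/ht/(leq_trans km).
have hm := hp m (leqnSn m); have hm1 := hp m.+1 (leqnn _).
have tm : t m.+1 < t m := ht m (leqnn _).
have sg0 : (-1) ^+ m.+1 != 0 :> R by rewrite signr_eq0.
have [|r /andP[r1 r2]] := @poly_ivt _ ((-1) ^+ m.+1 *: p) _ _ (ltW tm).
  by rewrite !hornerZ; move: hm hm1; rewrite exprS !mulN1r; lra.
rewrite rootZ // => rr.
have rn1 : r != t m.+1.
  by apply: contraTneq hm1 => <-; rewrite (rootP rr) mul0r ltxx.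
have rn2 : r != t m.
  by apply: contraTneq hm => <-; rewrite (rootP rr) mul0r ltxx.
have r1' : t m.+1 < r by rewrite lt_neqAle eq_sym rn1.
have r2' : r < t m by rewrite lt_neqAle rn2.
exists (r :: s); split=> /=.
- rewrite us andbT; apply/negP => /bs /andP[h _].
  by have := lt_trans h r2'; rewrite ltxx.
- by rewrite ss.
- by rewrite rr.
- move=> y; rewrite inE => /predU1P[->|/bs /andP[h1 h2]].
    by rewrite r1' (lt_le_trans r2' tm0).
  by rewrite h2 (lt_trans tm h1).
Qed.

Lemma cos_sin_nat_mul_pi (R : realType) (k : nat) :
  cos (k%:R * pi) = (-1) ^+ k :> R /\ sin (k%:R * pi) = 0 :> R.
Proof.
rewrite mulr_natl -[pi *+ k]add0r.
rewrite (alternatingn (@cosDpi R)) (alternatingn (@sinDpi R)).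
by rewrite cos0 sin0 mulr1 mulr0.
Qed.

Lemma three_term_trig (R : realType) (a : R) :
  three_term (cos a) (fun n => cos (n%:R * a)) /\
  three_term (cos a) (fun n => sin (n%:R * a)).
Proof.
have h : cos a ^+ 2 = 1 - sin a ^+ 2 by rewrite -(cos2Dsin2 a); ring.
split=> n;
  have -> : n.+2%:R * a = n%:R * a + a + a by rewrite -addn2 natrD; ring.
- have -> : n.+1%:R * a = n%:R * a + a by rewrite -addn1 natrD; ring.
  by rewrite !(cosD, sinD); ring: h.
- have -> : n.+1%:R * a = n%:R * a + a by rewrite -addn1 natrD; ring.
  by rewrite !(cosD, sinD); ring: h.
Qed.

(** The sample points are [cos (k pi / n)] for [0 <= k < n]: there are no more
    sign changes to find, since the last root lies beyond [1]. *)
Lemma P_inner_roots (R : realType) (n : nat) : (1 <= n)%N ->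
  exists s : seq R, [/\ uniq s, size s = (n - 1)%N, all (root (P R n)) s
    & forall y, y \in s -> -1 < y < 1].
Proof.
case: n => // m _; rewrite subn1 succnK.
have pi0 : 0 < pi :> R := pi_gt0 R.
have m0 : 0 < m.+1%:R :> R by rewrite ltr0n.
pose a k : R := k%:R * (pi / m.+1%:R).
have apos : 0 < pi / m.+1%:R :> R by rewrite divr_gt0.
have am1 : a m.+1 = pi by rewrite /a mulrC divfK ?gt_eqF.
have alt i j : (i < j)%N -> a i < a j by move=> ij; rewrite ltr_pM2r // ltr_nat.
have a0 : a 0%N = 0 by rewrite /a mul0r.
have ain k : (k <= m.+1)%N -> a k \in `[0, pi].
  move=> km; rewrite in_itv /= mulr_ge0 ?ler0n ?(ltW apos) //=.
  by rewrite -am1 ler_pM2r // ler_nat.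
have [k km|k km|s [us ss rs bs]] :=
  @sign_change_roots R (P R m.+1) (fun k => cos (a k)) m.
- have k1m : (k.+1 <= m.+1)%N := leqW km.
  by rewrite ltr_cos ?ain ?(ltnW k1m) // alt.
- case: k km => [|k] km.
    by rewrite a0 cos0 P_horner1 mulr1 oppr_lt0 ltr0n.
  have [hC hS] := three_term_trig (a k.+1).
  have := P_horner_CS hC hS; rewrite !mul0r !mul1r cos0 sin0.
  (* Here [sin (n a) = sin (k pi) = 0], which kills the second summand. *)
  move=> /(_ erefl erefl erefl m.+1).
  have -> : m.+1%:R * a k.+1 = k.+1%:R * pi.
    by rewrite /a; field; rewrite gt_eqF.
  have [-> ->] := cos_sin_nat_mul_pi R k.+1.
  have sk : sin (a k.+1) != 0.
    by rewrite gt_eqF // sin_gt0_pi // -a0 -am1 !alt.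
  rewrite mulr0 addr0 mulrC => /(mulIf sk) ->.
  by rewrite mulNr -expr2 sqrr_sign oppr_lt0.
exists s; split=> // y /bs /andP[]; rewrite a0 cos0 => h ->.
rewrite andbT; apply: lt_trans h; rewrite -cospi -am1 ltr_cos ?ain //.
exact: alt.
Qed.

(** * The isolated root *)

Lemma P_neq0 (R : realType) (n : nat) : P R n != 0.
Proof.
by apply: contraTneq (P_xinf_lt0 R n) => ->; rewrite horner0 ltxx.
Qed.

(** Together with [y], a root outside the list would make [n + 1] distinct
    roots of a nonzero polynomial of degree at most [n]. *)
Lemma P_root_complete (R : realType) (n : nat) (s : seq R) (z y : R) :
  (1 <= n)%N -> uniq s -> size s = (n - 1)%N -> all (root (P R n)) s ->
  (forall u, u \in s -> -1 < u < 1) ->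
  root (P R n) z -> ~~ (-1 < z < 1) -> root (P R n) y -> y \in z :: s.
Proof.
move=> n1 us ss rs bs rz zo ry; apply/negPn/negP => ys.
have zs : z \notin s by apply: contra zo; apply: bs.
have := @max_poly_roots _ _ [:: y, z & s] (P_neq0 R n).
rewrite /= ry rz rs zs us ys ss subn1 prednK // => /(_ isT isT) h.
by have := leq_trans h (size_P R n); rewrite ltnn.
Qed.

Lemma P_root_le (R : realType) (n : nat) (y : R) :
  xinf R < y -> 0 <= (P R n).[y] ->
  exists2 r, root (P R n) r & xinf R < r <= y.
Proof.
move=> hy py; have neg := P_xinf_lt0 R n.
have [|r /andP[r1 r2] rr] := @poly_ivt _ (P R n) _ _ (ltW hy).
  by rewrite (ltW neg).
exists r => //; rewrite r2 andbT lt_neqAle r1 andbT.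
by apply: contraTneq neg => ->; rewrite (rootP rr) ltxx.
Qed.

Lemma P_root_lt (R : realType) (n : nat) (y : R) :
  xinf R < y -> 0 < (P R n).[y] ->
  exists2 r, root (P R n) r & xinf R < r < y.
Proof.
move=> hy py; have [r rr /andP[r1 r2]] := P_root_le hy (ltW py).
exists r => //; rewrite r1 lt_neqAle r2 andbT.
by apply: contraTneq py => <-; rewrite (rootP rr) ltxx.
Qed.

(** Write [y = cosh w].  Eliminating [3 cosh w - 4] between the formula for
    [P_n (y) = 0] and that for [P_(n+1) (y)], the addition formulas leave
    [sinh (n w) * P_(n+1) (y) = sinh w]. *)
Lemma P_next_gt0 (R : realType) (n : nat) (y : R) : (1 <= n)%N ->
  1 < y -> root (P R n) y -> 0 < (P R n.+1).[y].
Proof.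
move=> n1 /cosh_surj[w w0 <-] /rootP ry.
have s0 := sinh_gt0 w0; have sn0 := sinh_gt0 (natM_gt0 n1 w0).
have h := P_horner_cosh n w; have h1 := P_horner_cosh n.+1 w.
have c2 := cosh_sqr (n%:R * w).
have e : n.+1%:R * w = n%:R * w + w by rewrite -addn1 natrD; ring.
rewrite e coshD sinhD in h1; rewrite ry mulr0 in h.
set p := (P R n.+1).[_] in h1 *.
have : sinh w * (sinh (n%:R * w) * p) = sinh w * sinh w.
  transitivity (sinh (n%:R * w) * (sinh w * p)); first by ring.
  rewrite h1.
  have h' : (3 * cosh w - 4) * sinh (n%:R * w) = cosh (n%:R * w) * sinh w.
    by lra.
  transitivity (- (cosh (n%:R * w) * cosh w + sinh (n%:R * w) * sinh w)
      * sinh w * sinh (n%:R * w)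
    + ((3 * cosh w - 4) * sinh (n%:R * w))
      * (sinh (n%:R * w) * cosh w + cosh (n%:R * w) * sinh w)); first by ring.
  by rewrite h'; ring: c2.
move=> /(mulfI (lt0r_neq0 s0)) hp.
by rewrite -(pmulr_rgt0 _ sn0) hp.
Qed.

(** With [y = cosh w] and [d = 3 cosh w - 4 - sinh w],
    [sinh w * P_n (y) = d * sinh (n w) - exp (- n w) * sinh w].  Beyond the
    limit point [d] is positive, so the first term tends to infinity while the
    second one stays bounded by [sinh w]. *)
Lemma P_eventually_gt0 (R : realType) (y : R) : xinf R < y ->
  \forall n \near \oo, 0 < (P R n).[y].
Proof.
move=> hy; have /andP[x1 _] := xinf_bounds R.
have [w w0 ew] := cosh_surj (lt_trans x1 hy).
have s0 := sinh_gt0 w0.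
have [s2 /andP[b1 b2]] := sqrt2_bounds R.
have [e1 e2] := expR_cosh_sinh w.
set z := expR w in e1; have ee : expR (- w) = z^-1 by rewrite expRN.
have z1 : 1 < z by rewrite -expR0 ltr_expR.
(* [2 + sqrt 2] is [exp v] for the [v > 0] with [cosh v = xinf]. *)
have hz : 2 + Num.sqrt 2 < z.
  rewrite ltNge; apply/negP => zle.
  have : z + z^-1 <= 2 + Num.sqrt 2 + (2 + Num.sqrt 2)^-1.
    case: (ltgtP z (2 + Num.sqrt 2)) zle => // [zlt _|-> //].
    by apply/ltW/addV_lt => //; exact: ltW.
  have -> : (2 + Num.sqrt 2)^-1 = 1 - Num.sqrt 2 / 2 :> R.
    have q0 : 2 + Num.sqrt 2 != 0 :> R by rewrite gt_eqF //; lra.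
    by apply: (mulfI q0); rewrite mulfV //; field: s2.
  by move: hy; rewrite -ew cosh_expR -/z /xinf; lra.
have d0 : 0 < 3 * cosh w - 4 - sinh w.
  have -> : 3 * cosh w - 4 - sinh w = z + 2 * z^-1 - 4.
    by rewrite -ee e1 e2; ring.
  have -> : z + 2 * z^-1 - 4 = ((z - 2) ^+ 2 - 2) / z.
    by field; rewrite gt_eqF //; lra.
  by apply: divr_gt0; nra.
set d := 3 * cosh w - 4 - sinh w in d0.
near=> n.
have hn : 2 * sinh w / (d * w) + 1 <= n%:R by near: n; exact: nbhs_infty_ger.
have nw0 : 0 <= n%:R * w by rewrite mulr_ge0 // ltW.
have [f1 f2] := expR_cosh_sinh (n%:R * w).
have f3 : expR (- (n%:R * w)) <= 1 by rewrite -[leRHS]expR0 ler_expR oppr_le0.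
have f4 := sinh_ge_half nw0.
have key : sinh w < d * (n%:R * w / 2).
  have dw : 0 < d * w by apply: mulr_gt0.
  have : 2 * sinh w / (d * w) < n%:R by lra.
  by rewrite ltr_pdivrMr //; lra.
rewrite -(pmulr_rgt0 _ s0) -ew P_horner_cosh.
have -> : - cosh (n%:R * w) * sinh w + (3 * cosh w - 4) * sinh (n%:R * w)
  = d * sinh (n%:R * w) - expR (- (n%:R * w)) * sinh w.
  by rewrite f2 /d; ring.
rewrite subr_gt0; apply: le_lt_trans (lt_le_trans key _).
  by rewrite ler_piMl // ltW.
by rewrite ler_pM2l.
Unshelve. all: by end_near. Qed.

Theorem proposition2 (R : realType) :
  exists x : nat -> R,
    [/\ (forall n : nat, (1 <= n)%N ->
          [/\ (exists s : seq R,
                 [/\ uniq s, size s = (n - 1)%N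
                   & forall y : R,
                       y \in s <-> -1 < y < 1 /\ root (P R n) y]),
              root (P R n) (x n),
              (6 + Num.sqrt 2) / 4 < x n <= 2,
              (forall y : R, root (P R n) y -> ~~ (-1 < y < 1) -> y = x n)
            & exists2 w : R,
                unique (fun v : R =>
                  0 < v /\ coth (n%:R * v) = (3 * cosh v - 4) / sinh v) w
                & x n = cosh w]),
        x 1%N = 2,
        (forall n : nat, (1 <= n)%N -> x n.+1 < x n)
      & x @ \oo --> (6 + Num.sqrt 2) / 4].
Proof.
have /andP[xi1 xi2] := xinf_bounds R.
have outer (y : R) : 1 < y -> ~~ (-1 < y < 1).
  by move=> y1; rewrite negb_and -!leNgt (ltW y1) orbT.
have /boolp.choice[x hx] n : exists r : R, (1 <= n)%N ->
    root (P R n) r /\ xinf R < r <= 2.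
  (* The sequence starts at [n = 1]; its entry at [0] is arbitrary. *)
  case: n => [|n]; first by exists 0.
  by have [//|r rr hr] := P_root_le xi2 (@P_horner2_ge0 R n.+1 _); exists r.
have x_root n : (1 <= n)%N -> root (P R n) (x n) by move=> /hx[].
have x_bounds n : (1 <= n)%N -> xinf R < x n <= 2 by move=> /hx[].
have x_gt1 n : (1 <= n)%N -> 1 < x n.
  by move=> /x_bounds/andP[h _]; apply: lt_trans h.
have x_unique n y : (1 <= n)%N -> root (P R n) y -> ~~ (-1 < y < 1) -> y = x n.
  move=> n1 ry yo; have [s [us ss rs bs]] := P_inner_roots R n1.
  have := P_root_complete n1 us ss rs bs (x_root _ n1)
    (outer _ (x_gt1 _ n1)) ry.
  by rewrite inE => /predU1P[//|/bs]; rewrite (negPf yo).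
have x_lt n y : (1 <= n)%N -> xinf R < y -> 0 < (P R n).[y] -> x n < y.
  move=> n1 hy py; have [r rr /andP[r1 r2]] := P_root_lt hy py.
  by rewrite -(x_unique n r n1 rr) // outer // (lt_trans xi1).
exists x; split=> [n n1||n n1|].
- split; [|exact: x_root|exact: x_bounds|by move=> y; apply: x_unique|].
  + have [s [us ss rs bs]] := P_inner_roots R n1.
    exists s; split=> // y; split=> [ys|[yi ry]].
      by rewrite (bs _ ys) (allP rs _ ys).
    have := P_root_complete n1 us ss rs bs (x_root _ n1)
      (outer _ (x_gt1 _ n1)) ry.
    rewrite inE => /predU1P[yx|//].
    by move: (outer _ (x_gt1 _ n1)); rewrite -yx yi.
  + have [w w0 ew] := cosh_surj (x_gt1 _ n1).
    exists w => //; split=> [|v [v0 /(coth_eq_root n1 v0) rv]].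
      by split=> //; apply/(coth_eq_root n1 w0); rewrite ew; apply: x_root.
    apply: cosh_inj_pos => //; rewrite ew; apply/esym/x_unique => //.
    by rewrite outer // cosh_gt1.
- by have /rootP := x_root 1%N isT; rewrite P1_horner; lra.
- have /andP[h _] := x_bounds _ n1.
  by apply: x_lt => //; apply: P_next_gt0 => //; [exact: x_gt1|exact: x_root].
- apply/cvgrPdist_lt => e e0; near=> n.
  have n1 : (1 <= n)%N by near: n; exact: nbhs_infty_ge.
  have /andP[h _] := x_bounds _ n1.
  rewrite -/(xinf R) distrC gtr0_norm ?subr_gt0 // ltrBlDl.
  apply: x_lt => //; first by rewrite ltrDl.
  by near: n; apply: P_eventually_gt0; rewrite ltrDl.
Unshelve. all: by end_near. Qed.
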